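(* Let $\mathcal{H}$ be a real Hilbert space, let $\theta_1,\theta_2\in\left]0,1\right[$, and let $T_1,T_2:\mathcal{H}\to\mathcal{H}$ be $\theta_1$-averaged and $\theta_2$-averaged mappings, respectively. Suppose that there exist scalars $\rho_1,\rho_2>0$ such that $$\theta_1\le\frac{\rho_2}{\rho_1+\rho_2}\quad\text{and}\quad\theta_2\le\frac{\rho_1}{\rho_1+\rho_2}.$$ Let $(x_{1,k})_{k=0}^{\infty}$ and $(x_{2,k})_{k=0}^{\infty}$ be sequences in $\mathcal{H}$ and let $x_1,x_2,y\in\mathcal{H}$ be such that, as $k\to\infty$, \begin{align*} &x_{1,k}\rightharpoonup x_1\quad\text{and}\quad x_{2,k}\rightharpoonup x_2,\\ &T_1(x_{1,k})\rightharpoonup y\quad\text{and}\quad T_2(x_{2,k})\rightharpoonup y,\\ &\rho_1\bigl(x_{1,k}-T_1(x_{1,k})\bigr)+\rho_2\bigl(x_{2,k}-T_2(x_{2,k})\bigr)\to 0,\\ &T_1(x_{1,k})-T_2(x_{2,k})\to 0. \end{align*} Then $T_1(x_1)=T_2(x_2)=y$.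
   Context: The symbols $\rightharpoonup$ and $\to$ denote weak and strong (norm) convergence in $\mathcal{H}$, respectively. A mapping $R:\mathcal{H}\to\mathcal{H}$ is nonexpansive if $\|R(x)-R(y)\|\le\|x-y\|$ for all $x,y\in\mathcal{H}$. For $\theta\in\left]0,1\right[$, a mapping $T:\mathcal{H}\to\mathcal{H}$ is $\theta$-averaged if there exists a nonexpansive mapping $R:\mathcal{H}\to\mathcal{H}$ such that $T=(1-\theta)\operatorname{Id}+\theta R$, where $\operatorname{Id}$ is the identity mapping on $\mathcal{H}$. *)

(* Defs.v *)
From HB Require Import structures.
From mathcomp Require Import all_boot all_order all_algebra.
From mathcomp Require Import all_classical all_reals all_analysis.
Set Implicit Arguments.
Unset Strict Implicit.
Unset Printing Implicit Defensive.
Import Order.TTheory GRing.Theory Num.Theory.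
Import numFieldNormedType.Exports.
Local Open Scope classical_set_scope.
Local Open Scope ring_scope.

(* A real Hilbert space is a complete normed space H over R together with a
   positive definite symmetric bilinear form whose induced norm is that of H. *)
Definition induces_norm (R : realType) (H : normedModType R)
    (dot : {dot H for idfun}) : Prop :=
  forall x : H, `|x| = Num.sqrt (dot x x).

Definition nonexpansive (R : realType) (H : normedModType R)
    (N : H -> H) : Prop :=
  forall x y : H, `|N x - N y| <= `|x - y|.

Definition averaged (R : realType) (H : normedModType R)
    (theta : R) (T : H -> H) : Prop :=
  exists N : H -> H,
    nonexpansive N /\ forall x : H, T x = (1 - theta) *: x + theta *: N x.

(* Convergence in the weak topology, the initial topology of the continuous
   dual: convergence against every continuous linear functional. *)
Definition weak_cvg (R : realType) (H : normedModType R)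
    (u : nat -> H) (l : H) : Prop :=
  forall f : {linear H -> R^o}, continuous f ->
    f (u k) @[k --> \oo] --> f l.

(* Main.v *)
(* Write p = T1 x1 - y, q = T2 x2 - y.  For an averaged T and points u, x, put
   a = T u - T x and c = rho (u - T u - (x - T x)); averagedness is a lower
   bound on <a, c> by a multiple of <c, c>, and the conditions on theta1 and
   theta2 make the two multiples opposite.  Adding the two bounds, the squared
   norms of c1 and c2 combine into <c1 - c2, c1 + c2>, while
   <a1, c1> + <a2, c2> = <a1, c1 + c2> - <c2, a1 - a2>.  As c1 + c2 and
   a1 - a2 converge in norm, every product pairs a weakly convergent sequence
   with a norm convergent one, so the inequality passes to the limit, where it
   says that a positive combination of |p|^2 and |q|^2 is nonpositive. *)

Require Import Defs.
From HB Require Import structures.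
From mathcomp Require Import all_boot all_order all_algebra.
From mathcomp Require Import all_classical all_reals all_analysis.
From mathcomp Require Import ring lra.
Set Implicit Arguments.
Unset Strict Implicit.
Unset Printing Implicit Defensive.
Import Order.TTheory GRing.Theory Num.Theory.
Import numFieldNormedType.Exports.
Local Open Scope classical_set_scope.
Local Open Scope ring_scope.

Lemma dotC (R : realType) (H : lmodType R) (dot : {dot H for idfun}) (x y : H) :
  dot x y = dot y x.
Proof. by rewrite hermitian_subproof expr0 mul1r. Qed.

Lemma dotZl (R : realType) (H : lmodType R) (dot : {dot H for idfun})
    (a : R) (x y : H) : dot (a *: x) y = a * dot x y.
Proof. exact: linearZl_LR. Qed.

Lemma dotZr (R : realType) (H : lmodType R) (dot : {dot H for idfun})
    (a : R) (x y : H) : dot x (a *: y) = a * dot x y.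
Proof. by rewrite dotC dotZl dotC. Qed.

Lemma dotBl (R : realType) (H : lmodType R) (dot : {dot H for idfun})
    (x y z : H) : dot (x - y) z = dot x z - dot y z.
Proof. exact: linearBl. Qed.

Lemma dotBr (R : realType) (H : lmodType R) (dot : {dot H for idfun})
    (x y z : H) : dot x (y - z) = dot x y - dot x z.
Proof. exact: linearBr. Qed.

Lemma dotDr (R : realType) (H : lmodType R) (dot : {dot H for idfun})
    (x y z : H) : dot x (y + z) = dot x y + dot x z.
Proof. exact: linearDr. Qed.

Lemma dotNl (R : realType) (H : lmodType R) (dot : {dot H for idfun})
    (x y : H) : dot (- x) y = - dot x y.
Proof. exact: linearNl. Qed.

Lemma dot_self_ge0 (R : realType) (H : lmodType R) (dot : {dot H for idfun})
    (x : H) : 0 <= dot x x.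
Proof.
have [->|x0] := eqVneq x 0; first by rewrite linear0r.
exact/ltW/neq0_dnorm_gt0.
Qed.

Lemma dot_self_le0_eq0 (R : realType) (H : lmodType R) (dot : {dot H for idfun})
    (x : H) : dot x x <= 0 -> x = 0.
Proof.
have [->//|x0] := eqVneq x 0.
by rewrite leNgt neq0_dnorm_gt0.
Qed.

Lemma dot_self (R : realType) (H : normedModType R) (dot : {dot H for idfun})
    (dot_norm : induces_norm dot) (x : H) : dot x x = `|x| ^+ 2.
Proof. by rewrite dot_norm sqr_sqrtr ?dot_self_ge0. Qed.

Lemma cauchy_schwarz (R : realType) (H : normedModType R)
    (dot : {dot H for idfun}) (dot_norm : induces_norm dot) (x y : H) :
  `|dot x y| <= `|x| * `|y|.
Proof.
have [->|y0] := eqVneq y 0; first by rewrite linear0r !normr0 mulr0.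
rewrite -ler_sqr ?nnegrE ?mulr_ge0// exprMn -normrX ger0_norm ?sqr_ge0//.
rewrite -!(dot_self dot_norm).
have yy : 0 < dot y y by exact: neq0_dnorm_gt0.
(* This vector is [dot y y] times the component of [x] orthogonal to [y]. Its squared norm equals
   [dot y y * (dot x x * dot y y - dot x y ^+ 2)], and the positive factor [dot y y] can be
   cancelled. *)
have := dot_self_ge0 dot (dot y y *: x - dot x y *: y).
rewrite !dotBl !dotBr !dotZl !dotZr (dotC dot y x) => h.
rewrite -subr_ge0 -(pmulr_rge0 _ yy).
by apply: le_trans h _; rewrite le_eqVlt; apply/orP; left; apply/eqP; ring.
Qed.

Lemma dot_continuous (R : realType) (H : normedModType R)
    (dot : {dot H for idfun}) (dot_norm : induces_norm dot) (x : H) :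
  continuous (dot x : H -> R^o).
Proof.
apply/(@linear_bounded_continuous _ H R^o (dot x))/bounded_funP => r.
exists (`|x| * r) => y yr.
by rewrite (le_trans (cauchy_schwarz dot_norm _ _))// ler_wpM2l.
Qed.

Lemma weak_cvg_dot (R : realType) (H : normedModType R)
    (dot : {dot H for idfun}) (dot_norm : induces_norm dot)
    (u : nat -> H) (l x : H) :
  weak_cvg u l -> dot (u k) x @[k --> \oo] --> dot l x.
Proof.
move=> /(_ _ (dot_continuous dot_norm (x := x))) /=.
by rewrite dotC; under eq_fun do rewrite dotC.
Qed.

(** Uniform boundedness principle for the functionals [dot (u k)]: they are pointwise bounded
    because each real sequence [dot (u k) x] converges. Completeness of [H] enters here. *)
Lemma weak_cvg_bounded (R : realType) (H : completeNormedModType R)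
    (dot : {dot H for idfun}) (dot_norm : induces_norm dot)
    (u : nat -> H) (l : H) :
  weak_cvg u l -> exists M, forall k, `|u k| <= M.
Proof.
move=> ul; pose F : set (H -> R^o) := range (fun k => (dot (u k) : H -> R^o)).
have linF f : F f -> bounded_fun_norm f /\ linear f.
  move=> [k _ <-]; split; last by move=> a x y; rewrite dotDr dotZr.
  move=> r; exists (`|u k| * r) => y yr.
  by rewrite (le_trans (cauchy_schwarz dot_norm _ _))// ler_wpM2l.
have ptF : pointwise_bounded F.
  move=> x; have : cvgn (fun k => dot (u k) x : R^o).
    by apply/cvg_ex; exists (dot l x); exact: (weak_cvg_dot dot_norm).
  move=> /cvg_seq_bounded/pinfty_ex_gt0[M _ uM].
  by exists M => _ [k _ <-]; exact: uM.
have [M FM] := Banach_Steinhauss linF ptF 1.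
exists M => k; have uF : F (dot (u k)) by exists k.
have [->|uk0] := eqVneq (u k) 0.
  by have := FM _ uF 0; rewrite normr0 linear0r normr0; exact.
have nuk : `|u k| != 0 by rewrite normr_eq0.
(* At this unit vector the functional [dot (u k)] takes the value [|u k|], so its bound on the unit
   ball bounds the norm. *)
have := FM _ uF (`|u k|^-1 *: u k).
rewrite normrZ normfV normr_id mulVf// => /(_ (lexx _)).
rewrite dotZr (dot_self dot_norm) expr2 mulKf// normr_id; exact.
Qed.

Lemma weak_cvgB (R : realType) (H : normedModType R) (u v : nat -> H)
    (l m : H) :
  weak_cvg u l -> weak_cvg v m -> weak_cvg (fun k => u k - v k) (l - m).
Proof.
move=> ul vm f cf; rewrite linearB; under eq_fun do rewrite linearB.
exact: (cvgB (ul f cf) (vm f cf)).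
Qed.

Lemma weak_cvgD (R : realType) (H : normedModType R) (u v : nat -> H)
    (l m : H) :
  weak_cvg u l -> weak_cvg v m -> weak_cvg (fun k => u k + v k) (l + m).
Proof.
move=> ul vm f cf; rewrite linearD; under eq_fun do rewrite linearD.
exact: (cvgD (ul f cf) (vm f cf)).
Qed.

Lemma weak_cvgZ (R : realType) (H : normedModType R) (a : R) (u : nat -> H)
    (l : H) :
  weak_cvg u l -> weak_cvg (fun k => a *: u k) (a *: l).
Proof.
move=> ul f cf; rewrite linearZ; under eq_fun do rewrite linearZ.
exact: (cvgZ (cvg_cst a) (ul f cf)).
Qed.

Lemma weak_cvg_cst (R : realType) (H : normedModType R) (x : H) :
  weak_cvg (fun=> x) x.
Proof. by move=> f _; exact: cvg_cst. Qed.

(** The functional [dot (l - m)] tends along [u] both to its value at [l] and to its value at [m];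
    equality of the two says that [l - m] has squared norm zero. *)
Lemma weak_strong_cvg_unique (R : realType) (H : normedModType R)
    (dot : {dot H for idfun}) (dot_norm : induces_norm dot)
    (u : nat -> H) (l m : H) :
  weak_cvg u l -> u k @[k --> \oo] --> m -> l = m.
Proof.
move=> ul um; apply/eqP; rewrite -subr_eq0; apply/eqP.
apply: (dot_self_le0_eq0 (dot := dot)); rewrite dotBr subr_le0 le_eqVlt.
apply/orP; left; apply/eqP.
have cf := dot_continuous dot_norm (x := l - m).
apply: (cvg_unique _ (ul _ cf)) => //.
exact: (continuous_cvg _ (cf m) um).
Qed.

(** Split [v k] as [m + (v k - m)]. The first part is weak convergence tested against [m]; the
    second is at most [M * |v k - m|], where [M] bounds the weakly convergent sequence. *)
Lemma cvg_dot (R : realType) (H : completeNormedModType R)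
    (dot : {dot H for idfun}) (dot_norm : induces_norm dot)
    (u v : nat -> H) (l m : H) :
  weak_cvg u l -> v k @[k --> \oo] --> m ->
  dot (u k) (v k) @[k --> \oo] --> dot l m.
Proof.
move=> ul vm; have [M uM] := weak_cvg_bounded dot_norm ul.
rewrite -[dot l m]addr0.
under eq_fun do rewrite -[v _](subrKC m) dotDr.
apply: cvgD; first exact: weak_cvg_dot.
apply/norm_cvg0P.
have M0 : M * `|v k - m| @[k --> \oo] --> 0.
  rewrite -[0](mulr0 M) -(normr0 H) -(subrr m).
  apply: cvgM; first exact: cvg_cst.
  apply: cvg_norm; apply: (cvgB vm). apply: (cvg_cst m).
apply: (squeeze_cvgr _ (cvg_cst 0) M0).
apply: nearW => k; rewrite normr_ge0/=.
by rewrite (le_trans (cauchy_schwarz dot_norm _ _))// ler_wpM2r.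
Qed.

(** Here [sigma] is the weight of the other mapping. Exchanging [rho] and [sigma] changes the sign
    of [rho - sigma] and keeps [2 * rho * sigma], so the instances for [T1] and [T2] can be
    added. *)
Lemma averaged_dot_ge (R : realType) (H : normedModType R)
    (dot : {dot H for idfun}) (dot_norm : induces_norm dot)
    (theta rho sigma : R) (T : H -> H) (u x : H) :
  0 < theta -> 0 < rho -> 0 < sigma -> theta <= sigma / (rho + sigma) ->
  averaged theta T ->
  (rho - sigma) * dot (rho *: (u - T u - (x - T x)))
                      (rho *: (u - T u - (x - T x))) <=
  2 * rho * sigma * dot (T u - T x) (rho *: (u - T u - (x - T x))).
Proof.
move=> theta0 rho0 sigma0; rewrite ler_pdivlMr ?addr_gt0// => theta_le.
move=> [N [Nne TN]]; set d := u - x; set n := N u - N x.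
have Tux : T u - T x = d - theta *: (d - n).
  rewrite !TN opprD addrACA -!scalerBr -/d -/n scalerBl scale1r.
  by rewrite (scalerBr theta d n) opprB addrA addrAC.
have -> : u - T u - (x - T x) = theta *: (d - n).
  by rewrite opprD addrACA -opprD -/d Tux opprB subrKC.
have nd : dot n n <= dot d d.
  by rewrite !(dot_self dot_norm) ler_sqr ?nnegrE//; exact: Nne.
rewrite Tux; clear Tux; clearbody d n.
rewrite !(dotZl, dotZr, dotBl, dotBr) (dotC dot n d).
have dn0 := dot_self_ge0 dot (d - n).
rewrite dotBl !dotBr (dotC dot n d) in dn0.
rewrite -subr_ge0.
set D := dot d d in nd dn0 *; set X := dot d n in dn0 *.
set M := dot n n in nd dn0 *.
(* By polarization, [2 <d, d - n> = |d - n|^2 + |d|^2 - |n|^2]. The coefficient of [|d - n|^2] is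
   nonnegative by the bound on [theta], and [D - M] is nonnegative because [N] is nonexpansive. *)
rewrite [leRHS](_ : _ = rho ^+ 2 * theta *
    ((sigma - theta * (rho + sigma)) * (D - X - (X - M)) + sigma * (D - M)));
  last by ring.
rewrite mulr_ge0 ?(mulr_ge0 (sqr_ge0 _) (ltW theta0))// addr_ge0//.
  by rewrite mulr_ge0// subr_ge0.
by rewrite mulr_ge0 ?subr_ge0// ltW.
Qed.

Theorem theorem3p4 (R : realType) (H : completeNormedModType R)
    (dot : {dot H for idfun}) (dot_norm : induces_norm dot)
    (theta1 theta2 : R)
    (theta1_01 : 0 < theta1 < 1) (theta2_01 : 0 < theta2 < 1)
    (T1 T2 : H -> H)
    (T1_avg : averaged theta1 T1) (T2_avg : averaged theta2 T2)
    (rho1 rho2 : R) (rho1_gt0 : 0 < rho1) (rho2_gt0 : 0 < rho2)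
    (theta1_le : theta1 <= rho2 / (rho1 + rho2))
    (theta2_le : theta2 <= rho1 / (rho1 + rho2))
    (u1 u2 : nat -> H) (x1 x2 y : H)
    (u1_x1 : weak_cvg u1 x1) (u2_x2 : weak_cvg u2 x2)
    (Tu1_y : weak_cvg (fun k => T1 (u1 k)) y)
    (Tu2_y : weak_cvg (fun k => T2 (u2 k)) y)
    (sum_to0 : rho1 *: (u1 k - T1 (u1 k)) + rho2 *: (u2 k - T2 (u2 k))
                 @[k --> \oo] --> (0 : H))
    (diff_to0 : T1 (u1 k) - T2 (u2 k) @[k --> \oo] --> (0 : H)) :
  T1 x1 = y /\ T2 x2 = y.
Proof.
have /andP[theta1_gt0 _] := theta1_01.
have /andP[theta2_gt0 _] := theta2_01.
pose p := T1 x1 - y; pose q := T2 x2 - y.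
pose a1 k := T1 (u1 k) - T1 x1; pose a2 k := T2 (u2 k) - T2 x2.
pose c1 k := rho1 *: (u1 k - T1 (u1 k) - (x1 - T1 x1)).
pose c2 k := rho2 *: (u2 k - T2 (u2 k) - (x2 - T2 x2)).
have wa1 : weak_cvg a1 (y - T1 x1).
  by apply: weak_cvgB => //; exact: weak_cvg_cst.
have wc1 : weak_cvg c1 (rho1 *: p).
  have -> : p = x1 - y - (x1 - T1 x1) by rewrite opprB addrC subrKA.
  by apply/weak_cvgZ/weak_cvgB; [exact: weak_cvgB|exact: weak_cvg_cst].
have wc2 : weak_cvg c2 (rho2 *: q).
  have -> : q = x2 - y - (x2 - T2 x2) by rewrite opprB addrC subrKA.
  by apply/weak_cvgZ/weak_cvgB; [exact: weak_cvgB|exact: weak_cvg_cst].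
(* The hypothesis [sum_to0] gives a norm limit expressed through [x1] and [x2]; uniqueness
   identifies it with the weak limit, which amounts to [rho1 (x1 - y) + rho2 (x2 - y) = 0]. *)
have cvg_c : c1 k + c2 k @[k --> \oo] --> rho1 *: p + rho2 *: q.
  have cvg_c : c1 k + c2 k @[k --> \oo] -->
      0 - (rho1 *: (x1 - T1 x1) + rho2 *: (x2 - T2 x2)).
    under eq_fun do rewrite /c1 /c2 !(scalerBr _ (_ - T1 _))
      !(scalerBr _ (_ - T2 _)) addrACA -opprD.
    by apply: cvgB sum_to0 _; exact: cvg_cst.
  by rewrite (weak_strong_cvg_unique dot_norm (weak_cvgD wc1 wc2) cvg_c).
have cvg_a : a1 k - a2 k @[k --> \oo] --> q - p.
  have -> : q - p = 0 - (T1 x1 - T2 x2).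
    by rewrite sub0r opprB /q /p opprB subrKA.
  under eq_fun do rewrite /a1 /a2 opprD addrACA -opprD.
  by apply: cvgB diff_to0 _; exact: cvg_cst.
have lim_le : (rho1 - rho2) *
    dot (rho1 *: p - rho2 *: q) (rho1 *: p + rho2 *: q) <=
    2 * rho1 * rho2 *
       (dot (y - T1 x1) (rho1 *: p + rho2 *: q) - dot (rho2 *: q) (q - p)).
  have L1 := cvg_dot dot_norm (weak_cvgB wc1 wc2) cvg_c.
  have L2 := cvg_dot dot_norm wa1 cvg_c.
  have L3 := cvg_dot dot_norm wc2 cvg_a.
  apply: (ler_cvg_to (cvgM (cvg_cst (rho1 - rho2)) L1)
                     (cvgM (cvg_cst (2 * rho1 * rho2)) (cvgB L2 L3))).
  apply: nearW => k; rewrite !fctE /=.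
  have I1 := averaged_dot_ge dot_norm (u1 k) x1 theta1_gt0 rho1_gt0 rho2_gt0
    theta1_le T1_avg.
  rewrite addrC in theta2_le.
  have I2 := averaged_dot_ge dot_norm (u2 k) x2 theta2_gt0 rho2_gt0 rho1_gt0
    theta2_le T2_avg.
  move: I1 I2; rewrite /= -/(c1 k) -/(c2 k) -/(a1 k) -/(a2 k).
  move: (a1 k) (a2 k) (c1 k) (c2 k) => v1 v2 w1 w2.
  (* By symmetry the cross terms [<w1, w2>] and [<v1, w2>] cancel, and what remains is the sum of
     the two bounds. *)
  rewrite !(dotBl, dotBr, dotDr) (dotC dot w2 w1).
  rewrite (dotC dot w2 v1) (dotC dot w2 v2).
  lra.
have pE : y - T1 x1 = - p by rewrite opprB.
have [p0 q0] : p = 0 /\ q = 0.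
  move: lim_le; rewrite pE; clearbody p q => lim_le.
  rewrite !(dotNl, dotBl, dotBr, dotDr, dotZl, dotZr) (dotC dot q p) in lim_le.
  have p0 := dot_self_ge0 dot p; have q0 := dot_self_ge0 dot q.
  (* The mixed products [<p, q>] cancel on both sides of [lim_le]. The coefficient of [|p|^2]
     becomes [rho1^2 (rho1 - rho2 + 2 rho2)], that of [|q|^2] becomes
     [rho2^2 (rho2 - rho1 + 2 rho1)], whence the common factor [rho1 + rho2]. *)
  have sum_le0 :
      (rho1 + rho2) * (rho1 ^+ 2 * dot p p + rho2 ^+ 2 * dot q q) <= 0.
    move: lim_le; rewrite -subr_le0; congr (_ <= _); ring.
  rewrite pmulr_rle0 ?addr_gt0// in sum_le0.
  have rp0 := mulr_ge0 (sqr_ge0 rho1) p0.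
  have rq0 := mulr_ge0 (sqr_ge0 rho2) q0.
  split; apply: (dot_self_le0_eq0 (dot := dot)).
  - rewrite -(pmulr_rle0 _ (exprn_gt0 2 rho1_gt0)); lra.
  - rewrite -(pmulr_rle0 _ (exprn_gt0 2 rho2_gt0)); lra.
by split; apply/eqP; rewrite -subr_eq0; apply/eqP.
Qed.
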